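(* Let $\Omega$ be a finite-dimensional real Euclidean space and $f_1,\dots,f_N\colon\Omega\to\mathbb{R}$ convex functions, each $\mu$-strongly convex and $L$-smooth for some $\mu,L>0$; let $E=\frac1N\sum_{j=1}^N f_j$ and let $\theta^*$ be its minimizer. Run DualFL (described in the context) with hyperparameters $\rho\in[0,\nu/L]$ and $\nu\in(0,\mu]$, and suppose that for some $\gamma>0$ the local iterates satisfy, for all $1\le j\le N$ and $n\ge0$, \[ \Gamma^{n,j}(\theta_j^{(n+1)}) \le \frac1N\left(\frac{1-\sqrt{\rho}}{1+\gamma}\right)^n . \] Then $\{\theta^{(n)}\}$ converges to $\theta^*$ and, for $n\ge 0$, \[ E(\theta^{(n)})-E(\theta^* ) \lesssim \|\theta^{(n)}-\theta^*\|^2 \lesssim (1-\sqrt{\rho})^n . \] In particular, with $\rho=\kappa^{-1}$ and $\nu=\mu$, where $\kappa=L/\mu$, one has $E(\theta^{(n)})-E(\theta^* )\lesssim\|\theta^{(n)}-\theta^*\|^2\lesssim(1-1/\sqrt{\kappa})^n$.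
   Context: $h$ is $\mu$-strongly convex if $h-\frac{\mu}{2}\|\cdot\|^2$ is convex; $h$ is $L$-smooth if it is differentiable with $L$-Lipschitz gradient; $h^*(p)=\sup_x\{\langle p,x\rangle-h(x)\}$ is the Legendre--Fenchel conjugate. $A\lesssim B$ means $A\le CB$ for a constant $C>0$ independent of $n$. DualFL with hyperparameters $\rho\ge0$, $\nu>0$: set $\theta^{(0)}=\theta_j^{(0)}=0$, $\zeta_j^{(0)}=\zeta_j^{(-1)}=0$, $t_0=1$. For $n=0,1,\dots$: each client $j$ computes an approximate minimizer $\theta_j^{(n+1)}$ of $E^{n,j}(\theta)=f_j(\theta)-\nu\langle\zeta_j^{(n)},\theta\rangle$; $\theta^{(n+1)}=\frac1N\sum_j\theta_j^{(n+1)}$; $t_{n+1}=\frac{1-\rho t_n^2+\sqrt{(1-\rho t_n^2)^2+4t_n^2}}{2}$, $\beta_n=\frac{t_n-1}{t_{n+1}}\cdot\frac{1-t_{n+1}\rho}{1-\rho}$; $\zeta_j^{(n+1)}=(1+\beta_n)(\zeta_j^{(n)}+\theta^{(n+1)}-\theta_j^{(n+1)})-\beta_n(\zeta_j^{(n-1)}+\theta^{(n)}-\theta_j^{(n)})$. Primal-dual gap: $g_j=f_j-\frac\nu2\|\cdot\|^2$, $E^{n,j}_{\mathrm d}(\xi)=g_j^*(\xi)+\frac1{2\nu}\|\xi-\nu\zeta_j^{(n)}\|^2$, $\Gamma^{n,j}(\theta)=E^{n,j}(\theta)+E^{n,j}_{\mathrm d}(\nu(\zeta_j^{(n)}-\theta))$.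 *)

(* Defs.v *)
From HB Require Import structures.
From mathcomp Require Import all_boot all_order all_algebra.
From mathcomp Require Import all_classical all_reals all_analysis.
Set Implicit Arguments. Unset Strict Implicit. Unset Printing Implicit Defensive.
Import Order.TTheory GRing.Theory Num.Theory.
Import numFieldNormedType.Exports.
Local Open Scope ring_scope.

(* The Euclidean space Omega is modelled as 'rV[R]_d with its standard inner
   product. *)
Definition inner {R : realType} {d : nat} (u v : 'rV[R]_d) : R :=
  \sum_(i < d) u ord0 i * v ord0 i.

Definition enorm {R : realType} {d : nat} (u : 'rV[R]_d) : R :=
  Num.sqrt (inner u u).

Definition convex_fun {R : realType} {d : nat} (h : 'rV[R]_d -> R) : Prop :=
  forall (x y : 'rV[R]_d) (t : R), 0 <= t -> t <= 1 ->
    h ((1 - t) *: x + t *: y) <= (1 - t) * h x + t * h y.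

Definition strongly_convex {R : realType} {d : nat} (mu : R)
  (h : 'rV[R]_d -> R) : Prop :=
  convex_fun (fun x => h x - mu / 2 * enorm x ^+ 2).

Definition L_smooth {R : realType} {d : nat} (L : R) (h : 'rV[R]_d -> R) : Prop :=
  exists grad : 'rV[R]_d -> 'rV[R]_d,
    (forall x, differentiable h x /\ forall v, 'd h x v = inner (grad x) v) /\
    (forall x y, enorm (grad x - grad y) <= L * enorm (x - y)).

Definition conjugate {R : realType} {d : nat} (h : 'rV[R]_d -> R)
  (p : 'rV[R]_d) : \bar R :=
  ereal_sup [set ((inner p x - h x)%:E) | x in [set: 'rV[R]_d]].

Fixpoint dfl_t {R : realType} (rho : R) (n : nat) : R :=
  match n with
  | 0 => 1
  | n'.+1 => let tn := dfl_t rho n' in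
      (1 - rho * tn ^+ 2 + Num.sqrt ((1 - rho * tn ^+ 2) ^+ 2 + 4 * tn ^+ 2)) / 2
  end.

Definition dfl_beta {R : realType} (rho : R) (n : nat) : R :=
  (dfl_t rho n - 1) / dfl_t rho n.+1 * ((1 - dfl_t rho n.+1 * rho) / (1 - rho)).

(* theta^(n) = (1/N) sum_j theta_j^(n), where thl n j = theta_j^(n). *)
Definition dfl_avg {R : realType} {d N : nat} (thl : nat -> 'I_N -> 'rV[R]_d)
  (n : nat) : 'rV[R]_d :=
  N%:R^-1 *: \sum_(j < N) thl n j.

(* (zeta_j^(n), zeta_j^(n-1)), with zeta_j^(0) = zeta_j^(-1) = 0. *)
Fixpoint dfl_zeta_pair {R : realType} {d N : nat} (rho : R)
  (thl : nat -> 'I_N -> 'rV[R]_d) (j : 'I_N) (n : nat) : 'rV[R]_d * 'rV[R]_d :=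
  match n with
  | 0 => (0, 0)
  | n'.+1 =>
      let zz := dfl_zeta_pair rho thl j n' in
      let b := dfl_beta rho n' in
      ((1 + b) *: (zz.1 + dfl_avg thl n'.+1 - thl n'.+1 j)
         - b *: (zz.2 + dfl_avg thl n' - thl n' j), zz.1)
  end.

Definition dfl_zeta {R : realType} {d N : nat} (rho : R)
  (thl : nat -> 'I_N -> 'rV[R]_d) (j : 'I_N) (n : nat) : 'rV[R]_d :=
  (dfl_zeta_pair rho thl j n).1.

Definition dfl_E {R : realType} {d N : nat} (f : 'I_N -> 'rV[R]_d -> R)
  (rho nu : R) (thl : nat -> 'I_N -> 'rV[R]_d) (n : nat) (j : 'I_N)
  (th : 'rV[R]_d) : R :=
  f j th - nu * inner (dfl_zeta rho thl j n) th.

Definition dfl_Ed {R : realType} {d N : nat} (f : 'I_N -> 'rV[R]_d -> R)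
  (rho nu : R) (thl : nat -> 'I_N -> 'rV[R]_d) (n : nat) (j : 'I_N)
  (xi : 'rV[R]_d) : \bar R :=
  (conjugate (fun x => (f j x - nu / 2 * enorm x ^+ 2)%R) xi
   + ((2 * nu)^-1 * enorm (xi - nu *: dfl_zeta rho thl j n) ^+ 2)%:E)%E.

Definition dfl_Gamma {R : realType} {d N : nat} (f : 'I_N -> 'rV[R]_d -> R)
  (rho nu : R) (thl : nat -> 'I_N -> 'rV[R]_d) (n : nat) (j : 'I_N)
  (th : 'rV[R]_d) : \bar R :=
  ((dfl_E f rho nu thl n j th)%:E
   + dfl_Ed f rho nu thl n j (nu *: (dfl_zeta rho thl j n - th)))%E.

(* Main.v *)
Require Import Defs.
From HB Require Import structures.
From mathcomp Require Import all_boot all_order all_algebra.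
From mathcomp Require Import all_classical all_reals all_analysis.
From mathcomp Require Import ring lra.
Import Order.TTheory GRing.Theory Num.Theory.
Import numFieldNormedType.Exports.
Local Open Scope classical_set_scope.
Local Open Scope ring_scope.
Set Implicit Arguments. Unset Strict Implicit. Unset Printing Implicit Defensive.

(* Put g_j = f_j - nu/2 |.|^2 and xi_j^(n+1) = nu (zeta_j^(n) - theta_j^(n+1)).
   The gap Gamma^{n,j}(theta_j^(n+1)) is the Fenchel-Young defect
   g_j(theta) + g_j^*(xi) - <xi, theta>, so the stopping criterion says that xi
   is an eps_n-subgradient of g_j at theta.  DualFL is thus inexact FISTA with
   step nu on the dual energy sum_j g_j^*(xi_j) + 1/(2 N nu) |sum_j xi_j|^2,
   where averaging gives theta^(n) = - (mean of xi^(n)) / nu.  Since g_j is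
   (L - nu)-smooth, g_j^* is strongly convex; for an inexact step only a fraction
   1 - s of the modulus survives, at the price eps_n / s.  The usual Lyapunov
   function (dual gap plus scaled squared distance of the momentum point to the
   optimum) then satisfies
     Psi_(n+1) <= (1 + 2 r^n) (1 - 1/t_(n+1)) Psi_n + 4 a^n r^n
   with a = 1 - sqrt rho and r = (1 + gamma)^(-1/2), for the choice s_n = r^n / 2,
   and it bounds |theta^(n+1) - theta*|^2.  The values of g_j^* never enter: at
   the iterates they are replaced by <xi, theta> - g_j(theta) + eps_n.  For
   rho = 1 the g_j are affine, and a finite gap forces exact local solutions. *)

(** * The Euclidean inner product on row vectors *)

Section InnerProduct.
Variables (R : realType) (d : nat).
Implicit Types (u v w : 'rV[R]_d) (a : R).

Lemma innerC u v : inner u v = inner v u.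
Proof. by apply: eq_bigr => i _; rewrite mulrC. Qed.

Lemma innerDl u v w : inner (u + v) w = inner u w + inner v w.
Proof. by rewrite -big_split; apply: eq_bigr => i _; rewrite mxE mulrDl. Qed.

Lemma innerZl a u v : inner (a *: u) v = a * inner u v.
Proof. by rewrite mulr_sumr; apply: eq_bigr => i _; rewrite mxE mulrA. Qed.

Lemma innerNl u v : inner (- u) v = - inner u v.
Proof. by rewrite -scaleN1r innerZl mulN1r. Qed.

Lemma innerDr u v w : inner u (v + w) = inner u v + inner u w.
Proof. by rewrite !(innerC u) innerDl. Qed.

Lemma innerZr a u v : inner u (a *: v) = a * inner u v.
Proof. by rewrite !(innerC u) innerZl. Qed.

Lemma innerNr u v : inner u (- v) = - inner u v.
Proof. by rewrite !(innerC u) innerNl. Qed.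

Lemma inner0l u : inner 0 u = 0.
Proof. by rewrite -(scale0r 0) innerZl mul0r. Qed.

Definition innerE := (innerDl, innerDr, innerNl, innerNr, innerZl, innerZr).

Lemma inner_suml (I : Type) (r : seq I) (P : pred I) (F : I -> 'rV[R]_d) u :
  inner (\sum_(i <- r | P i) F i) u = \sum_(i <- r | P i) inner (F i) u.
Proof.
by apply: (big_morph (inner^~ u)) => [v w|]; [exact: innerDl | exact: inner0l].
Qed.

Lemma inner_ge0 u : 0 <= inner u u.
Proof. by apply: sumr_ge0 => i _; rewrite -expr2 sqr_ge0. Qed.

Lemma sqr_enorm u : enorm u ^+ 2 = inner u u.
Proof. by rewrite sqr_sqrtr // inner_ge0. Qed.

Lemma coord_sqr_le_inner u i : u ord0 i ^+ 2 <= inner u u.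
Proof.
rewrite /inner (bigD1 i) //= expr2 lerDl.
by apply: sumr_ge0 => k _; rewrite -expr2 sqr_ge0.
Qed.

Lemma inner_eq0 u : inner u u = 0 -> u = 0.
Proof.
move=> u0; apply/rowP => i; rewrite mxE.
by have := coord_sqr_le_inner u i; rewrite u0 exprn_even_le0 //= => /eqP.
Qed.

Lemma inner_le_enorm u v : inner u v <= enorm u * enorm v.
Proof.
have [v0|v_neq0] := eqVneq (inner v v) 0.
  by rewrite (inner_eq0 v0) innerC inner0l mulr_ge0 ?sqrtr_ge0.
have v_gt0 : 0 < inner v v by rewrite lt_neqAle eq_sym v_neq0 inner_ge0.
rewrite -sqrtrM ?inner_ge0 //; apply: (le_trans (ler_norm _)).
rewrite -sqrtr_sqr ler_wsqrtr //.
have := inner_ge0 (inner v v *: u - inner u v *: v).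
rewrite !innerE (innerC v u) => H.
by rewrite -(ler_pM2l v_gt0); nra.
Qed.

End InnerProduct.

(** * Quadratic bounds from smoothness and strong convexity *)

Section Smoothness.
Variables (R : realType) (d : nat).
Implicit Types (x y v w p : 'rV[R]_d) (f : 'rV[R]_d -> R).

Lemma is_derive_line f x w (s : R) : differentiable f (x + s *: w) ->
  is_derive s 1 (fun r => f (x + r *: w)) ('d f (x + s *: w) w).
Proof.
move=> df; have dw := diff_derivable (v := w) df.
have E : (fun h : R => h^-1 *: (f (x + (h *: 1 + s) *: w) - f (x + s *: w)))
  = (fun h : R => h^-1 *: (f (h *: w + (x + s *: w)) - f (x + s *: w))).
  apply/funext => h; congr (_ *: (f _ - _)).
  by rewrite scalerDl addrCA /GRing.scale/= mulr1.
split; first by rewrite /derivable /= E.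
by rewrite -deriveE // /derive /= E.
Qed.

(** Along the segment, subtracting the linear and quadratic terms leaves a function [phi] whose
    derivative is nonpositive, by Cauchy-Schwarz and the Lipschitz bound; the mean value theorem
    concludes. *)
Lemma descent_lemma f (G : 'rV[R]_d -> 'rV[R]_d) (L : R) :
  (forall x, differentiable f x /\ forall v, 'd f x v = inner (G x) v) ->
  (forall x y, enorm (G x - G y) <= L * enorm (x - y)) ->
  forall x w, f (x + w) <= f x + inner (G x) w + L / 2 * inner w w.
Proof.
move=> dfG lipG x w.
pose phi := fun s : R =>
  f (x + s *: w) - (s * inner (G x) w + L / 2 * inner w w * s ^+ 2).
have dphi (s : R) : is_derive s (1 : R) phi (inner (G (x + s *: w)) w
   - (inner (G x) w + L * inner w w * s)).
  have [df dfE] := dfG (x + s *: w).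
  have D1 := is_derive_line df; rewrite dfE in D1.
  have D2 : is_derive s (1 : R)
      (fun r : R => r * inner (G x) w + L / 2 * inner w w * r ^+ 2)
      (inner (G x) w + L * inner w w * s).
    have -> : (fun r : R => r * inner (G x) w + L / 2 * inner w w * r ^+ 2) =
      (inner (G x) w \*: (id : R -> R)) + (L / 2 * inner w w) \*: ((id : R -> R) ^+ 2).
      by apply/funext => r; rewrite /GRing.scale /= mulrC.
    by apply: is_derive_eq; rewrite /GRing.scale /=; field.
  exact: is_deriveB.
have cphi : {within `[0, 1], continuous phi}.
  by apply: derivable_within_continuous => s _; exact: ex_derive.
have [c /[!in_itv]/= /andP[c0 c1]] := MVT ltr01 (fun s _ => dphi s) cphi.
rewrite subr0 mulr1 /phi scale1r scale0r addr0 expr1n expr0n /= => E.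
have : inner (G (x + c *: w) - G x) w <= L * c * inner w w.
  apply: (le_trans (inner_le_enorm _ _)).
  have := lipG (x + c *: w) x; rewrite addrAC subrr add0r => lip.
  have : enorm (c *: w) = c * enorm w.
    by rewrite /enorm !innerE mulrA -expr2 sqrtrM ?sqr_ge0 // sqrtr_sqr gtr0_norm.
  move=> cw; rewrite -sqr_enorm expr2 mulrA ler_wpM2r ?sqrtr_ge0 //.
  by rewrite -mulrA -cw.
rewrite innerDl innerNl => H; lra.
Qed.

(** The lower bound is the descent lemma for [- f]. Only these two bounds, and no derivatives, are
    carried further. *)
Lemma L_smooth_bounds f L : L_smooth L f -> exists G : 'rV[R]_d -> 'rV[R]_d,
  forall x w, f (x + w) <= f x + inner (G x) w + L / 2 * inner w w /\
              f x + inner (G x) w - L / 2 * inner w w <= f (x + w).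
Proof.
case=> G [dfG lipG]; exists G => x w; split; first exact: descent_lemma.
have H := @descent_lemma (- f) (fun y => - G y) L.
have {H} := H _ _ x w => H.
have : (- f) (x + w) <= (- f) x + inner (- G x) w + L / 2 * inner w w.
  apply: H => [y|y z]; last by rewrite -opprD {1}/enorm innerNl innerNr opprK -/(enorm _).
  have [df dfE] := dfG y; split; first exact: differentiableN.
  by move=> v; rewrite diffN //= innerNl -dfE.
rewrite innerNl => H1; have e y : (- f) y = - f y by [].
rewrite !e in H1; lra.
Qed.

(* The lower quadratic bound replaces differentiability: it makes the error of
   the affine approximation second order along segments. *)
Lemma convex_fun_subgradient f p x (C : R) : convex_fun f ->
  (forall w, f x + inner p w - C * inner w w <= f (x + w)) ->
  forall w, f x + inner p w <= f (x + w).
Proof.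
move=> cf lb w; rewrite leNgt; apply/negP => lt.
pose e := f x + inner p w - f (x + w).
have e0 : 0 < e by rewrite subr_gt0.
have key (t : R) : 0 < t -> t <= 1 -> e <= t * C * inner w w.
  move=> t0 t1.
  have := cf x (x + w) t (ltW t0) t1.
  have -> : (1 - t) *: x + t *: (x + w) = x + t *: w.
    by rewrite scalerDr addrA -scalerDl subrK scale1r.
  move=> H; have := lb (t *: w); rewrite !innerE => H2.
  rewrite -(ler_pM2l t0) /e; nra.
have q0 := inner_ge0 w.
pose M := `|C| * inner w w + e.
have M0 : 0 < M by rewrite ltr_wpDl // mulr_ge0.
have t0 : 0 < e / (2 * M) by rewrite divr_gt0 // mulr_gt0.
have t1 : e / (2 * M) <= 1.
  have : e <= M by rewrite lerDr mulr_ge0.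
  by rewrite ler_pdivrMr; lra.
have := key _ t0 t1; apply/negP; rewrite -ltNge.
have -> : e / (2 * M) * C * inner w w = e * (C * inner w w / M) / 2.
  by field; rewrite gt_eqF.
have : C * inner w w / M <= 1.
  rewrite ler_pdivrMr // mul1r /M.
  have := ler_wpM2r q0 (ler_norm C); lra.
move=> h; nra.
Qed.

(** Apply the convex case to [f - mu/2 |.|^2], with slope [p - mu *: x] and defect [C + mu / 2]. *)
Lemma strongly_convex_subgradient f mu nu p x (C : R) : strongly_convex mu f ->
  nu <= mu ->
  (forall w, f x + inner p w - C * inner w w <= f (x + w)) ->
  forall w, f x + inner p w + nu / 2 * inner w w <= f (x + w).
Proof.
move=> cf numu lb w.
have H : forall w, f x - mu / 2 * enorm x ^+ 2 + inner (p - mu *: x) w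
     - (C + mu / 2) * inner w w <= f (x + w) - mu / 2 * enorm (x + w) ^+ 2.
  by move=> u; have := lb u; rewrite !sqr_enorm !innerE (innerC u x); lra.
have := @convex_fun_subgradient (fun x => f x - mu / 2 * enorm x ^+ 2) _ _ _ cf H w.
rewrite /= !sqr_enorm !innerE (innerC w x).
have := ler_wpM2r (inner_ge0 w) numu; lra.
Qed.

End Smoothness.

(** * The step parameters [t] *)

Section Steps.
Variables (R : realType) (rho : R).
Hypotheses (rho_ge0 : 0 <= rho) (rho_le1 : rho <= 1).
Local Notation t := (dfl_t rho).
Local Notation sigma := (Num.sqrt rho).

(** [t n.+1] is the positive root of [X^2 - (1 - rho t_n^2) X - t_n^2]. *)
Lemma dfl_tS n : t n.+1 ^+ 2 - t n.+1 = t n ^+ 2 * (1 - rho * t n.+1).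
Proof.
rewrite /=; set c := 1 - rho * t n ^+ 2; set q := Num.sqrt _.
have q2 : q ^+ 2 = c ^+ 2 + 4 * t n ^+ 2.
  by rewrite sqr_sqrtr // addr_ge0 ?sqr_ge0 // mulr_ge0 ?sqr_ge0.
have e : rho * t n ^+ 2 = 1 - c by rewrite /c; ring.
have -> : t n ^+ 2 * (1 - rho * ((c + q) / 2)) =
  t n ^+ 2 - (rho * t n ^+ 2) * ((c + q) / 2) by ring.
have -> : ((c + q) / 2) ^+ 2 = (c ^+ 2 + 2 * c * q + q ^+ 2) / 4 by field.
by rewrite e q2; field.
Qed.

(** The second bound gives [1 - 1/t <= 1 - sqrt rho], the contraction factor of the final rate. *)
Lemma dfl_t_bounds n : 1 <= t n /\ sigma * t n <= 1.
Proof.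
have s0 : 0 <= sigma := sqrtr_ge0 _.
have s2 : sigma ^+ 2 = rho by rewrite sqr_sqrtr.
have s1 : sigma <= 1 by rewrite -sqrtr1 ler_sqrt.
elim: n => [|n [t1 st1]]; first by rewrite /= mulr1.
have E := dfl_tS n.
have x_gt0 : 0 < t n.+1.
  rewrite /= divr_gt0 //; set c := 1 - _.
  have : `|c| < Num.sqrt (c ^+ 2 + 4 * t n ^+ 2).
    have t2 : 0 < 4 * t n ^+ 2 by rewrite mulr_gt0 // exprn_gt0 //; lra.
    by rewrite -sqrtr_sqr ltr_sqrt ?ltrDl // ltr_wpDl // sqr_ge0.
  by have := ler_norm (- c); rewrite normrN; lra.
set x := t n.+1 in E x_gt0 *; set y := t n in E t1 st1 *.
have st0 : 0 <= sigma * y by rewrite mulr_ge0 //; lra.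
split.
  rewrite leNgt; apply/negP => x1.
  have rx : rho * x <= x by rewrite ler_piMl // ltW.
  have : 0 < y ^+ 2 * (1 - rho * x).
    by rewrite mulr_gt0 ?exprn_gt0 ?subr_gt0 //; lra.
  have xx : x ^+ 2 <= x by rewrite expr2 ler_piMl // ltW.
  lra.
have E2 : (sigma * x) ^+ 2 - sigma * (sigma * x) =
  (sigma * y) ^+ 2 * (1 - sigma * (sigma * x)).
  have -> : (sigma * x) ^+ 2 - sigma * (sigma * x) = sigma ^+ 2 * (x ^+ 2 - x).
    by ring.
  have -> : sigma ^+ 2 * (x ^+ 2 - x) = sigma ^+ 2 * (y ^+ 2 * (1 - sigma ^+ 2 * x)).
    by rewrite E s2.
  ring.
have p0 : 0 <= sigma * x by rewrite mulr_ge0 // ltW.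
set p := sigma * x in E2 p0 *; set q := sigma * y in E2 st0 st1.
(* For the rescaled [p] and [q] the recurrence gives [p^2 <= 1] if [sigma * p <= 1], and
   [p <= sigma] otherwise. *)
have q1 : q ^+ 2 <= 1 by nra.
have q0 : 0 <= q ^+ 2 by exact: sqr_ge0.
have [h|h] := leP 0 (1 - sigma * p).
  have : q ^+ 2 * (1 - sigma * p) <= 1 - sigma * p by nra.
  move=> h2; nra.
have : q ^+ 2 * (1 - sigma * p) <= 0 by nra.
move=> h2; nra.
Qed.

(** Needed for [rho = 0], where [1 - sqrt rho = 1] gives no decay: the factors [1 - 1/t] are then at
    most [1 - 1/(n+2)]. *)
Lemma dfl_t_le n : t n <= n.+1%:R.
Proof.
elim: n => [//|n IH].
have [t1 _] := dfl_t_bounds n; have [u1 _] := dfl_t_bounds n.+1.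
have E := dfl_tS n; apply: (@le_trans _ _ (1 + t n)); last first.
  by rewrite -[in leRHS]natr1 addrC lerD2r.
set x := t n.+1 in E u1 *; set y := t n in E t1 *.
rewrite leNgt; apply/negP => lt.
have : y ^+ 2 * (1 - rho * x) <= y ^+ 2.
  by rewrite ler_piMr ?sqr_ge0 // gerDl oppr_le0 mulr_ge0 //; lra.
rewrite -E => h; nra.
Qed.

End Steps.

(** * Perturbed linear recurrences *)

Section Recurrences.
Variables (R : realType) (Psi alpha : nat -> R) (a r B : R).
Hypotheses (a_gt0 : 0 < a) (r_ge0 : 0 <= r) (r_lt1 : r < 1) (B_ge0 : 0 <= B)
  (Psi_ge0 : forall n, 0 <= Psi n).
Hypothesis (PsiS : forall n,
  Psi n.+1 <= (1 + 2 * r ^+ n) * (alpha n * Psi n) + B * a ^+ n * r ^+ n).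

Lemma perturbed_geometric_bound : (forall n, alpha n <= a) ->
  exists2 C, 0 < C & forall n, Psi n <= C * a ^+ n.
Proof.
move=> alpha_le.
(* With this shift, [Psi n / a^n + b] obeys a homogeneous recurrence with factor [1 + 2 r^n]. The
   extra 1 in [C] makes it positive. *)
pose b := B / (2 * a).
have b0 : 0 <= b by rewrite divr_ge0 ?mulr_ge0 // ltW.
pose C := (Psi 0%N + b + 1) * expR (2 / (1 - r)).
exists C.
  by rewrite mulr_gt0 ?expR_gt0 // ltr_wpDl // addr_ge0.
(* [1 + x <= expR x] turns the product of the factors [1 + 2 r^i] into the
   exponential of a geometric sum. *)
have key n : Psi n <=
  ((Psi 0%N + b + 1) * expR (2 * ((1 - r ^+ n) / (1 - r))) - b) * a ^+ n.
  elim: n => [|n IH].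
    by rewrite !expr0 subrr mul0r mulr0 expR0 !mulr1; lra.
  have rn : 0 <= r ^+ n by rewrite exprn_ge0.
  have an : 0 < a ^+ n by rewrite exprn_gt0.
  have f0 : 0 <= 1 + 2 * r ^+ n by rewrite addr_ge0 // mulr_ge0.
  apply: (le_trans (PsiS n)).
  set X := (_ + 1) * _ in IH.
  have X0 : 0 <= X by rewrite mulr_ge0 ?expR_ge0 // !addr_ge0.
  have h1 : alpha n * Psi n <= a * ((X - b) * a ^+ n).
    apply: (@le_trans _ _ (a * Psi n)); first by rewrite ler_wpM2r.
    by rewrite ler_pM2l.
  apply: (@le_trans _ _ (((1 + 2 * r ^+ n) * X - b) * a ^+ n.+1)).
    have := ler_wpM2l f0 h1.
    have -> : B * a ^+ n * r ^+ n = 2 * b * r ^+ n * a ^+ n.+1.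
      by rewrite /b exprS; field; rewrite gt_eqF.
    rewrite exprS => h; set A := a ^+ n in h *.
    apply: (le_trans (lerD h (lexx _))); rewrite le_eqVlt; apply/orP; left.
    by apply/eqP; ring.
  rewrite ler_wpM2r ?exprn_ge0 ?(ltW a_gt0) // lerD2r.
  have -> : 2 * ((1 - r ^+ n.+1) / (1 - r)) =
     2 * ((1 - r ^+ n) / (1 - r)) + 2 * r ^+ n.
    by rewrite exprS; field; rewrite subr_eq0 gt_eqF.
  rewrite expRD mulrA [leRHS]mulrC ler_wpM2r //.
  exact: expR_ge1Dx.
move=> n; apply: (le_trans (key n)); rewrite ler_wpM2r ?exprn_ge0 ?(ltW a_gt0) //.
apply: (@le_trans _ _ ((Psi 0%N + b + 1) * expR (2 * ((1 - r ^+ n) / (1 - r))))).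
  by rewrite gerDl oppr_le0.
rewrite /C ler_wpM2l ?addr_ge0 // ler_expR ler_wpM2l //.
by rewrite ler_piMl ?invr_ge0 ?subr_ge0 ?(ltW r_lt1) // gerDl oppr_le0 exprn_ge0.
Qed.

End Recurrences.

(** Multiplied by [n+2], the recurrence lets [(n+1) Psi_n] grow by at most [(n+2) M r^n], which is
    summable. *)
Lemma perturbed_harmonic_bound (R : realType) (Psi : nat -> R) (r M : R) :
  0 <= r -> r < 1 -> 0 <= M ->
  (forall n, Psi n.+1 <= (1 - n.+2%:R^-1) * Psi n + M * r ^+ n) ->
  exists C, forall n, Psi n <= C / n.+1%:R.
Proof.
move=> r0 r1 M0 PsiS.
have s0 : 0 < 1 - r by rewrite subr_gt0.
(* The correction term is chosen so that [Q] is nonincreasing. *)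
pose Q n := n.+1%:R * Psi n + M / (1 - r) * (n.+2%:R + (1 - r)^-1) * r ^+ n.
have QS n : Q n.+1 <= Q n.
  have n2 : n.+2%:R != 0 :> R by rewrite pnatr_eq0.
  have h : n.+2%:R * Psi n.+1 <= n.+1%:R * Psi n + n.+2%:R * M * r ^+ n.
    have := ler_wpM2l (ler0n R n.+2) (PsiS n).
    rewrite mulrDr !mulrA mulrBr mulfV // mulr1.
    by rewrite -[in _ - 1]natr1 addrK.
  have e : n.+3%:R = n.+2%:R + 1 :> R by rewrite natr1.
  rewrite /Q e exprS; set y := r ^+ n in h *.
  have y0 : 0 <= y by rewrite exprn_ge0.
  rewrite -subr_ge0.
  have -> : n.+1%:R * Psi n + M / (1 - r) * (n.+2%:R + (1 - r)^-1) * y -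
    (n.+2%:R * Psi n.+1 + M / (1 - r) * (n.+2%:R + 1 + (1 - r)^-1) * (r * y))
    = (n.+1%:R * Psi n + n.+2%:R * M * y - n.+2%:R * Psi n.+1) + M * y.
    by field; rewrite gt_eqF.
  by rewrite addr_ge0 ?mulr_ge0 // subr_ge0.
exists (Q 0%N) => n.
have Qn : Q n <= Q 0%N by elim: n => [//|n]; exact: le_trans.
rewrite ler_pdivlMr ?ltr0n // mulrC; apply: le_trans Qn.
rewrite /Q lerDl; apply: mulr_ge0; last by rewrite exprn_ge0.
by rewrite mulr_ge0 ?addr_ge0 ?divr_ge0 ?invr_ge0 // ltW.
Qed.

(** * Strong convexity of the conjugate, exact and inexact *)

Section Conjugate.
Variables (R : realType) (d : nat).
Implicit Types (x y w p xi th : 'rV[R]_d) (g : 'rV[R]_d -> R).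

(* [H] stands for the value of the conjugate of [g] at [y]: only the upper bound
   property is used. *)
Lemma conjugate_strong_lower g p th y (l m H : R) :
  0 <= m -> m * l <= 1 ->
  (forall w, g (th + w) <= g th + inner p w + l / 2 * inner w w) ->
  (forall x, inner y x - g x <= H) ->
  inner y th - g th + m / 2 * inner (y - p) (y - p) <= H.
Proof.
move=> m0 ml up ub; have q0 := inner_ge0 (y - p).
(* Test the supremum at [th + m (y - p)]: the gain is [m |y - p|^2], and [m * l <= 1] limits the
   smoothness cost to half of it. *)
have := ub (th + m *: (y - p)); have := up (m *: (y - p)).
have e : inner y (y - p) = inner p (y - p) + inner (y - p) (y - p).
  by rewrite -innerDl [p + _]addrC subrK.
rewrite innerDr !innerZr innerZl e; set q := inner (y - p) _ in q0 *.
move=> h1 h2; have : m * l * (m * q) <= m * q by rewrite ler_piMl // mulr_ge0.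
have e2 : l / 2 * (m * (m * q)) = (m * l * (m * q)) / 2 by ring.
lra.
Qed.

(** The slack is [|s x + y|^2 / s]. *)
Lemma inner_young x y (s : R) : 0 < s ->
  (1 - s) * inner x x - (s^-1 - 1) * inner y y <= inner (x + y) (x + y).
Proof.
move=> s0; have := inner_ge0 (s *: x + y).
rewrite !innerE (innerC y x) => h; rewrite -subr_ge0.
have -> : inner x x + inner x y + (inner x y + inner y y)
   - ((1 - s) * inner x x - (s^-1 - 1) * inner y y)
  = s^-1 * (s * (s * inner x x + inner x y) + (s * inner x y + inner y y)).
  by field; rewrite gt_eqF.
by rewrite mulr_ge0 ?invr_ge0 // ltW.
Qed.

(* The left-hand side starts with an upper bound for the conjugate at [xi]. *)
Lemma conjugate_inexact_lower g p th xi y (l m e s H : R) :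
  0 <= m -> m * l <= 1 -> 0 < s -> s <= 1 ->
  (forall w, g (th + w) <= g th + inner p w + l / 2 * inner w w) ->
  (forall x, inner xi x - g x <= inner xi th - g th + e) ->
  (forall x, inner y x - g x <= H) ->
  (inner xi th - g th + e) + inner th (y - xi)
    + m / 2 * (1 - s) * inner (y - xi) (y - xi) - e / s <= H.
Proof.
move=> m0 ml s0 s1 up ubxi uby.
(* The strong bound is centred at the gradient [p]. Applied at [xi] it yields [m/2 |xi - p|^2 <= e],
   so [inner_young] can recentre it at [xi]. *)
have h1 := conjugate_strong_lower m0 ml up uby.
have h2 := conjugate_strong_lower m0 ml up ubxi.
have h3 := inner_young (y - xi) (xi - p) s0.
rewrite addrA subrK in h3.
have q : 0 <= s^-1 - 1 by rewrite subr_ge0 -[leLHS]invr1 lef_pV2 ?posrE.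
set X := inner (xi - p) _ in h2 h3; set Y := inner (y - xi) (y - xi) in h3 *.
set Z := inner (y - p) _ in h1 h3.
have h4 : (s^-1 - 1) * (m / 2 * X) <= (s^-1 - 1) * e by rewrite ler_wpM2l //; lra.
have h5 : m / 2 * ((1 - s) * Y - (s^-1 - 1) * X) <= m / 2 * Z.
  by rewrite ler_wpM2l // divr_ge0.
rewrite innerDr innerNr !(innerC th).
have -> : e / s = e + (s^-1 - 1) * e by ring.
lra.
Qed.

End Conjugate.

(** * One proximal gradient step on the dual energy *)

Lemma natr_sum_const (R : realType) (N : nat) (c : R) :
  N%:R * c = \sum_(j < N) c.
Proof. by rewrite sumr_const card_ord mulr_natl. Qed.

Section DualStep.
Variables (R : realType) (d N : nat) (nu m s : R) (v w : 'I_N -> 'rV[R]_d).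
Variables (q W : 'rV[R]_d) (th : 'I_N -> 'rV[R]_d) (Hw : 'I_N -> R) (e : R).
Hypotheses (nu_gt0 : 0 < nu)
  (sum_v : \sum_j v j = - (nu * N%:R) *: q)
  (sum_w : \sum_j w j = - (nu * N%:R) *: W)
  (thE : forall j, nu *: th j = v j + nu *: q - w j).

(* The quadratic part of the dual energy only sees the sum of the components; it
   is [1 / nu]-smooth, and [N nu / 2] times the squared norm of the averaged
   primal variable. *)
Lemma dual_step (y : 'I_N -> 'rV[R]_d) (Hy : 'I_N -> R) (Y : 'rV[R]_d) :
  \sum_j y j = - (nu * N%:R) *: Y ->
  (forall j, Hw j + inner (th j) (y j - w j)
     + m / 2 * (1 - s) * inner (y j - w j) (y j - w j) - e <= Hy j) ->
  (2 * nu)^-1 * ((1 + nu * m * (1 - s)) * \sum_j inner (y j - w j) (y j - w j)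
      - \sum_j inner (y j - v j) (y j - v j)) - N%:R * e <=
  (\sum_j Hy j + N%:R * nu / 2 * inner Y Y)
   - (\sum_j Hw j + N%:R * nu / 2 * inner W W).
Proof.
move=> sum_y HyP.
have nu0 : nu != 0 by rewrite gt_eqF.
pose A := \sum_j inner (y j - w j) (y j - w j).
pose B := \sum_j inner (y j - v j) (y j - v j).
pose C := \sum_j inner (v j - w j) (v j - w j).
have hC : N%:R * nu ^+ 2 * inner (q - W) (q - W) <= C.
  have : 0 <= \sum_j inner (v j - w j + nu *: (q - W)) (v j - w j + nu *: (q - W)).
    by apply: sumr_ge0 => j _; exact: inner_ge0.
  have -> : \sum_j inner (v j - w j + nu *: (q - W)) (v j - w j + nu *: (q - W))
    = C + 2 * nu * inner (\sum_j (v j - w j)) (q - W)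
        + N%:R * nu ^+ 2 * inner (q - W) (q - W).
    rewrite /C inner_suml mulr_sumr -[N%:R * _ * _]mulrA (natr_sum_const N).
    rewrite -!big_split; apply: eq_bigr => j _ /=.
    move: (q - W) (v j - w j) => a b.
    by rewrite !innerE (innerC a b); ring.
  rewrite sumrB sum_v sum_w -scalerBr innerZl; lra.
(* Three-point identity [2 <v-w, y-w> = |v-w|^2 + |y-w|^2 - |y-v|^2]; by [hC], the [|v-w|^2] part
   pays for the quadratic error at [q]. *)
have hs : \sum_j inner (th j) (y j - w j) =
   (2 * nu)^-1 * (C + A - B) - N%:R * nu * inner q (Y - W).
  have -> : N%:R * nu * inner q (Y - W) = - inner (\sum_j (y j - w j)) q.
    by rewrite sumrB sum_y sum_w -scalerBr innerZl innerC; ring.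
  rewrite inner_suml opprK /A /B /C -sumrN -!big_split mulr_sumr -big_split /=.
  apply: eq_bigr => j _.
  have -> : th j = nu^-1 *: (v j + nu *: q - w j) by rewrite -thE scalerA mulVf // scale1r.
  rewrite !innerE (innerC (w j) (v j)) (innerC (y j) (v j)) (innerC (y j) (w j)).
  by rewrite (innerC (y j) q) (innerC (w j) q); field.
have hH : \sum_j Hw j + \sum_j inner (th j) (y j - w j)
    + m / 2 * (1 - s) * A - N%:R * e <= \sum_j Hy j.
  rewrite /A mulr_sumr (natr_sum_const N) -sumrN -!big_split.
  by apply: ler_sum => j _; exact: HyP.
have hF : N%:R * nu * inner q (Y - W) =
  N%:R * nu / 2 * (inner Y Y - inner W W) + N%:R * nu / 2 *
    (inner (q - W) (q - W) - inner (Y - q) (Y - q)).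
  by rewrite !innerE (innerC W q) (innerC Y q); field.
have hY : 0 <= N%:R * nu / 2 * inner (Y - q) (Y - q).
  by rewrite mulr_ge0 ?inner_ge0 // divr_ge0 // mulr_ge0 // ltW.
have hC2 : N%:R * nu / 2 * inner (q - W) (q - W) <= (2 * nu)^-1 * C.
  have i0 : 0 <= (2 * nu)^-1 by rewrite invr_ge0 mulr_ge0 // ltW.
  have := ler_wpM2l i0 hC; congr (_ <= _); by field.
rewrite -/A -/B.
have -> : (2 * nu)^-1 * ((1 + nu * m * (1 - s)) * A - B)
  = (2 * nu)^-1 * (A - B) + m / 2 * (1 - s) * A by field.
rewrite hs hF in hH.
have e1 : (2 * nu)^-1 * (C + A - B) = (2 * nu)^-1 * C + (2 * nu)^-1 * (A - B) by ring.
rewrite e1 in hH; lra.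
Qed.

End DualStep.

(* The coefficient of [z - a] vanishes for [kappa = 1 / (1 - rho)] when
   [omega = (1 - t rho) / (1 - rho)]: this is what the momentum coefficient is
   designed for. *)
Lemma momentum_inner (R : realType) (d : nat) (a w v z p : 'rV[R]_d)
  (t omega kappa : R) : 0 < t -> 0 <= omega -> omega <= 1 ->
  v = a + (omega / t) *: (p - a) ->
  kappa / t ^+ 2 * inner (z - (a + t *: (w - a))) (z - (a + t *: (w - a)))
  - omega / t ^+ 2 * inner (z - p) (z - p)
  + ((kappa - 1) * (t - 1) - (1 - omega)) / t ^+ 2 * inner (z - a) (z - a) <=
  (1 - t^-1) * (kappa * inner (a - w) (a - w) - inner (a - v) (a - v))
  + t^-1 * (kappa * inner (z - w) (z - w) - inner (z - v) (z - v)).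
Proof.
move=> t0 o0 o1 ->; rewrite /inner !mulr_sumr -!sumrN -!big_split /=.
rewrite !mulr_sumr -!big_split /=.
apply: ler_sum => i _; rewrite !mxE.
move: (a ord0 i) (w ord0 i) (z ord0 i) (p ord0 i) => a' w' z' p'.
rewrite -subr_ge0.
set X := (X in 0 <= X).
have -> : X = omega * (1 - omega) / t ^+ 2 * (p' - a') ^+ 2.
  by rewrite /X; field; rewrite gt_eqF.
by rewrite mulr_ge0 ?sqr_ge0 // divr_ge0 ?sqr_ge0 // mulr_ge0 // subr_ge0.
Qed.

(** * DualFL in dual variables *)

Section Iterates.
Variables (R : realType) (d N : nat) (rho nu : R) (thl : nat -> 'I_N -> 'rV[R]_d).
Hypotheses (N_gt0 : (0 < N)%N) (nu_gt0 : 0 < nu) (thl0 : forall j, thl 0%N j = 0).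

(** The value 0 at index 0 is [nu (zeta^(-1) - theta^(0))] for the zero initial data. *)
Definition dual_iter n (j : 'I_N) : 'rV[R]_d :=
  if n is k.+1 then nu *: (dfl_zeta rho thl j k - thl k.+1 j) else 0.

Arguments dual_iter : simpl never.

Lemma dual_iterS n j : dual_iter n.+1 j = nu *: (dfl_zeta rho thl j n - thl n.+1 j).
Proof. by []. Qed.

Definition primal_extrap n : 'rV[R]_d :=
  if n is k.+1 then (1 + dfl_beta rho k) *: dfl_avg thl k.+1
    - dfl_beta rho k *: dfl_avg thl k else 0.

(** The FISTA extrapolation point, as [dual_extrapS] confirms; its mean is
    [- nu *: primal_extrap n]. *)
Definition dual_extrap n (j : 'I_N) : 'rV[R]_d :=
  nu *: dfl_zeta rho thl j n - nu *: primal_extrap n.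

Lemma dfl_avg0 : dfl_avg thl 0 = 0.
Proof. by rewrite /dfl_avg big1 ?scaler0. Qed.

Lemma sum_thl n : \sum_j thl n j = N%:R *: dfl_avg thl n.
Proof. by rewrite scalerA mulfV ?scale1r // pnatr_eq0 -lt0n. Qed.

Lemma dfl_zetaS j n : dfl_zeta rho thl j n.+1 =
  (1 + dfl_beta rho n) *: (nu^-1 *: dual_iter n.+1 j + dfl_avg thl n.+1)
  - dfl_beta rho n *: (nu^-1 *: dual_iter n j + dfl_avg thl n).
Proof.
have nu0 : nu != 0 by rewrite gt_eqF.
rewrite /dfl_zeta /=; congr (_ *: _ - _ *: _).
  by rewrite dual_iterS scalerA mulVf // scale1r addrAC.
case: n => [|n] /=; first by rewrite thl0 subr0 scaler0.
by rewrite dual_iterS scalerA mulVf // scale1r addrAC.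
Qed.

(** The two claims feed each other: a zero sum of [zeta] gives the sum of the next dual iterate,
    which cancels against the averages in [dfl_zetaS]. *)
Lemma sum_dual_iter n :
  \sum_j dual_iter n j = - (nu * N%:R) *: dfl_avg thl n /\
  \sum_j dfl_zeta rho thl j n = 0.
Proof.
have nu0 : nu != 0 by rewrite gt_eqF.
elim: n => [|n [IHxi IHz]].
  by rewrite dfl_avg0 scaler0 !big1.
have xiS : \sum_j dual_iter n.+1 j = - (nu * N%:R) *: dfl_avg thl n.+1.
  by rewrite -scaler_sumr sumrB IHz sum_thl sub0r scalerN scalerA scaleNr.
split=> //; under eq_bigr do rewrite dfl_zetaS.
rewrite sumrB -!scaler_sumr !big_split /= -!(scaler_sumr nu^-1).
have cancel k : \sum_j dual_iter k j = - (nu * N%:R) *: dfl_avg thl k ->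
    nu^-1 *: \sum_j dual_iter k j + \sum_(j < N) dfl_avg thl k = 0.
  move=> ->; rewrite scalerA mulrN mulrA mulVf // mul1r.
  by rewrite sumr_const card_ord scaleNr scaler_nat addNr.
by rewrite (cancel n.+1) // (cancel n) // !scaler0 subrr.
Qed.

Lemma sum_dual_extrap n :
  \sum_j dual_extrap n j = - (nu * N%:R) *: primal_extrap n.
Proof.
rewrite sumrB -!scaler_sumr (sum_dual_iter n).2 scaler0 sub0r.
by rewrite sumr_const card_ord -scaler_nat scalerA scaleNr.
Qed.

Lemma thl_dual_extrap n j :
  nu *: thl n.+1 j = dual_extrap n j + nu *: primal_extrap n - dual_iter n.+1 j.
Proof. by rewrite /dual_extrap subrK dual_iterS scalerBr subKr. Qed.

Lemma dual_extrapS n j : dual_extrap n.+1 j =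
  dual_iter n.+1 j + dfl_beta rho n *: (dual_iter n.+1 j - dual_iter n j).
Proof.
have nu0 : nu != 0 by rewrite gt_eqF.
rewrite /dual_extrap dfl_zetaS /primal_extrap.
move: (dual_iter n.+1 j) (dual_iter n j) (dfl_avg _ _) (dfl_avg _ _) => x y a b.
by apply/rowP => i; rewrite !mxE; field.
Qed.

End Iterates.

Arguments dual_iter : simpl never.

(** Since [xi - nu z = - nu th], the gap collapses to the Fenchel-Young defect. Bounding the
    conjugate below by its term at [x] leaves a real inequality. *)
Lemma dfl_Gamma_subgradient (R : realType) (d N : nat)
  (f : 'I_N -> 'rV[R]_d -> R) (rho nu : R) (thl : nat -> 'I_N -> 'rV[R]_d)
  n j (e : R) : 0 < nu ->
  (dfl_Gamma f rho nu thl n j (thl n.+1 j) <= e%:E)%E ->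
  forall x, inner (dual_iter rho nu thl n.+1 j) x
      - (f j x - nu / 2 * inner x x) <=
    inner (dual_iter rho nu thl n.+1 j) (thl n.+1 j)
      - (f j (thl n.+1 j) - nu / 2 * inner (thl n.+1 j) (thl n.+1 j)) + e.
Proof.
move=> nu0 + x; rewrite /dfl_Gamma /dfl_Ed /dfl_E /=.
set z := dfl_zeta _ _ _ _; set th := thl _ _; set xi := nu *: (z - th).
set h := fun y => _; move=> G.
have lb : ((inner xi x - h x)%:E <= conjugate h xi)%E.
  by apply: ereal_sup_ubound; exists x.
have : ((f j th - nu * inner z th)%:E + ((inner xi x - h x)%:E
   + ((2 * nu)^-1 * enorm (xi - nu *: z) ^+ 2)%:E) <= e%:E)%E.
  by apply: le_trans G; rewrite leeD2l // leeD2r.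
rewrite -!EFinD lee_fin /h !sqr_enorm.
have -> : (2 * nu)^-1 * inner (xi - nu *: z) (xi - nu *: z) = nu / 2 * inner th th.
  have -> : xi - nu *: z = - (nu *: th) by rewrite /xi scalerBr addrAC subrr add0r.
  by rewrite innerNl innerNr opprK innerZl innerZr; field; rewrite gt_eqF.
rewrite /xi !innerE; lra.
Qed.

(** * Lyapunov analysis *)

Section Convergence.
Variables (R : realType) (d N : nat) (f : 'I_N -> 'rV[R]_d -> R) (L rho nu c : R).
Variables (thl : nat -> 'I_N -> 'rV[R]_d) (thetas : 'rV[R]_d).
Variable G : 'I_N -> 'rV[R]_d -> 'rV[R]_d.
Hypotheses (N_gt0 : (0 < N)%N) (nu_gt0 : 0 < nu)
  (thl0 : forall j, thl 0%N j = 0).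

Local Notation g := (fun j x => f j x - nu / 2 * inner x x).
Local Notation xi := (dual_iter rho nu thl).
Local Notation A := (dfl_avg thl).
Local Notation z := (fun j => G j thetas - nu *: thetas).
Local Notation t := (dfl_t rho).
Local Notation eps := (fun n => N%:R^-1 * c ^+ n).

Hypotheses
  (f_up : forall j x w, f j (x + w) <= f j x + inner (G j x) w + L / 2 * inner w w)
  (f_low : forall j w, f j thetas + inner (G j thetas) w + nu / 2 * inner w w
     <= f j (thetas + w))
  (sumG : \sum_j G j thetas = 0)
  (xi_sub : forall n j x, inner (xi n.+1 j) x - g j x <=
     inner (xi n.+1 j) (thl n.+1 j) - g j (thl n.+1 j) + eps n).

Lemma g_up j x w :
  g j (x + w) <= g j x + inner (G j x - nu *: x) w + (L - nu) / 2 * inner w w.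
Proof. by have := f_up j x w; rewrite /= !innerE (innerC w x); lra. Qed.

(** [z j] is the slope of [g j] at [thetas]; the [z j] form the dual optimum. *)
Lemma z_sub j x : inner (z j) x - g j x <= inner (z j) thetas - g j thetas.
Proof.
have := f_low j (x - thetas); rewrite addrCA subrr addr0 /= !innerE.
rewrite (innerC x thetas); lra.
Qed.

Lemma sum_z : \sum_j z j = - (nu * N%:R) *: thetas.
Proof.
rewrite sumrB sumG sumr_const card_ord sub0r -scaler_nat scalerA scaleNr.
by rewrite [N%:R * _]mulrC.
Qed.

(** Here [g j] lies below its tangent at [thetas], so [<xi, x> - g j x] would be unbounded along
    [xi - z] unless the two agree. *)
Lemma xi_eq_z : L <= nu -> forall n j, xi n.+1 j = z j.
Proof.
move=> Lnu n j; apply/eqP; rewrite -subr_eq0; apply/eqP/inner_eq0.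
set D := _ - _; pose K := inner (xi n.+1 j) (thl n.+1 j) - g j (thl n.+1 j)
   + eps n + g j thetas - inner (xi n.+1 j) thetas.
have key (r : R) : r * inner D D <= K.
  have := xi_sub n j (thetas + r *: D); have := g_up j thetas (r *: D).
  have : (L - nu) / 2 * inner (r *: D) (r *: D) <= 0.
    by rewrite mulr_le0_ge0 ?inner_ge0 //; lra.
  have -> : inner (xi n.+1 j) (thetas + r *: D) = inner (xi n.+1 j) thetas
     + (r * inner D D + inner (z j) (r *: D)).
    rewrite innerDr innerZr innerZr; congr (_ + _).
    by rewrite -mulrDr -innerDl /D subrK.
  rewrite /K; lra.
apply/eqP; rewrite eq_le inner_ge0 andbT leNgt; apply/negP => D0.
have := key ((K + 1) / inner D D); rewrite divfK ?gt_eqF //; lra.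
Qed.

Lemma dfl_avg_eq n : (forall j, xi n j = z j) -> A n = thetas.
Proof.
move=> e; have := (sum_dual_iter rho N_gt0 nu_gt0 thl0 n).1.
have nz : - (nu * N%:R) != 0 by rewrite oppr_eq0 mulf_neq0 ?gt_eqF // ltr0n.
by under eq_bigr do rewrite e; rewrite sum_z => /(scalerI nz).
Qed.

Hypotheses (rho_ge0 : 0 <= rho) (rho_lt1 : rho < 1) (rho_le : rho * L <= nu).

(** [m] is a strong convexity modulus for the conjugates: [m (L - nu) <= 1] amounts to
    [rho L <= nu]. Moreover [K = 1 + nu m]. *)
Local Notation K := ((1 - rho)^-1).
Local Notation m := (rho / (nu * (1 - rho))).
Local Notation H n := (fun j => inner (xi n.+1 j) (thl n.+1 j) - g j (thl n.+1 j) + eps n).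
Local Notation Hs := (fun j => inner (z j) thetas - g j thetas).

(** Index [n] refers to [xi n.+1], the first dual iterate with a certified conjugate bound being
    [xi 1]. *)
Definition dual_gap n : R :=
  (\sum_j (inner (xi n.+1 j) (thl n.+1 j) - g j (thl n.+1 j) + eps n)
    + N%:R * nu / 2 * inner (A n.+1) (A n.+1))
  - (\sum_j (inner (z j) thetas - g j thetas) + N%:R * nu / 2 * inner thetas thetas).

Definition dual_momentum n (j : 'I_N) : 'rV[R]_d := xi n j + t n *: (xi n.+1 j - xi n j).

Definition lyapunov n : R := dual_gap n + K / (2 * nu * t n ^+ 2) *
  \sum_j inner (z j - dual_momentum n j) (z j - dual_momentum n j).

Let m_ge0 : 0 <= m.
Proof. by rewrite divr_ge0 // mulr_ge0 ?subr_ge0 // ltW. Qed.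

Let mL : m * (L - nu) <= 1.
Proof.
rewrite mulrAC ler_pdivrMr ?mulr_gt0 ?subr_gt0 // mul1r.
by rewrite !mulrBr mulr1 [nu * rho]mulrC lerD2r.
Qed.

(** Each conjugate has slope [thetas] at [z j]; the sum formula for [xi] turns the linear terms into
    the cross term of the square. *)
Lemma dual_gap_ge n : N%:R * nu / 2 * inner (A n.+1 - thetas) (A n.+1 - thetas)
  + m / 2 * \sum_j inner (xi n.+1 j - z j) (xi n.+1 j - z j) <= dual_gap n.
Proof.
have h : \sum_j (inner (xi n.+1 j) thetas - g j thetas
    + m / 2 * inner (xi n.+1 j - z j) (xi n.+1 j - z j)) <= \sum_j H n j.
  apply: ler_sum => j _; apply: (@conjugate_strong_lower _ _ (g j) (z j) thetas _ (L - nu)) => //.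
  by move=> w; exact: g_up.
rewrite big_split sumrB -mulr_sumr -inner_suml /= in h.
rewrite (sum_dual_iter rho N_gt0 nu_gt0 thl0 n.+1).1 innerZl in h.
have hs : \sum_j Hs j = - (nu * N%:R) * inner thetas thetas - \sum_j g j thetas.
  by rewrite sumrB -inner_suml sum_z innerZl.
rewrite /dual_gap hs; move: (A n.+1) h => y h.
rewrite !innerE (innerC thetas y); lra.
Qed.

Lemma lyapunov_step n (s : R) : 0 < s -> s <= 1 ->
  (1 - s) * lyapunov n.+1 <=
  (1 + s) * ((1 - (t n.+1)^-1) * lyapunov n) + N%:R * (eps n.+1 / s).
Proof.
move=> s0 s1.
have [T1 _] := dfl_t_bounds rho_ge0 (ltW rho_lt1) n.
have [t1 st1] := dfl_t_bounds rho_ge0 (ltW rho_lt1) n.+1.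
have tE := dfl_tS rho n.
have rt : rho * t n.+1 <= 1.
  have s_le1 : Num.sqrt rho <= 1 by rewrite -sqrtr1 ler_sqrt // ltW.
  rewrite -[rho in rho * _]sqr_sqrtr // expr2 -mulrA.
  by rewrite mulr_ile1 ?sqrtr_ge0 // mulr_ge0 ?sqrtr_ge0 //; lra.
have step := dual_step nu_gt0
   (sum_dual_extrap rho N_gt0 nu_gt0 thl0 n.+1)
   (sum_dual_iter rho N_gt0 nu_gt0 thl0 n.+2).1
   (thl_dual_extrap rho nu thl n.+1).
have lower j y Hy : (forall x, inner y x - g j x <= Hy) ->
    H n.+1 j + inner (thl n.+2 j) (y - xi n.+2 j)
     + m / 2 * (1 - s) * inner (y - xi n.+2 j) (y - xi n.+2 j) - eps n.+1 / s <= Hy.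
  by apply: (conjugate_inexact_lower m_ge0 mL s0 s1 (g_up _ _)); exact: xi_sub.
(* The two FISTA comparison points, the previous iterate and the optimum, get weights [1 - tau] and
   [tau]. *)
have S1 := step m s (H n.+1) (eps n.+1 / s) (xi n.+1) (H n) (A n.+1)
  (sum_dual_iter rho N_gt0 nu_gt0 thl0 n.+1).1 (fun j => lower j _ _ (xi_sub n j)).
have S2 := step m s (H n.+1) (eps n.+1 / s) z Hs thetas
  sum_z (fun j => lower j _ _ (z_sub j)).
have gap0 k : 0 <= dual_gap k.
  apply: le_trans (dual_gap_ge k); apply: addr_ge0.
    by rewrite mulr_ge0 ?inner_ge0 // divr_ge0 // mulr_ge0 // ltW.
  rewrite mulr_ge0 //; first by rewrite divr_ge0 //; exact: m_ge0.
  by apply: sumr_ge0 => j _; exact: inner_ge0.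
pose omega := (1 - rho * t n.+1) / (1 - rho).
have r1 : 1 - rho != 0 by rewrite subr_eq0 gt_eqF.
have o0 : 0 <= omega by rewrite divr_ge0 ?subr_ge0 // ltW.
have o1 : omega <= 1.
  rewrite ler_pdivrMr ?subr_gt0 // mul1r lerD2l lerN2 ler_peMr //.
have tp : 0 < t n.+1 by lra.
have Tp : 0 < t n by lra.
have vE j : dual_extrap rho nu thl n.+1 j =
    xi n.+1 j + (omega / t n.+1) *: (dual_momentum n j - xi n.+1 j).
  rewrite dual_extrapS // /dual_momentum /dfl_beta /omega.
  by apply/rowP => i; rewrite !mxE; field; rewrite r1 gt_eqF.
(* [K] with the reduced modulus: [kappa = (1 - s) K + s]. *)
pose kappa := 1 + nu * m * (1 - s).
pose U k := \sum_j inner (z j - dual_momentum k j) (z j - dual_momentum k j).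
pose Zd := \sum_j inner (z j - xi n.+1 j) (z j - xi n.+1 j).
pose Aw := \sum_j inner (xi n.+1 j - xi n.+2 j) (xi n.+1 j - xi n.+2 j).
pose Av := \sum_j inner (xi n.+1 j - dual_extrap rho nu thl n.+1 j)
  (xi n.+1 j - dual_extrap rho nu thl n.+1 j).
pose Zw := \sum_j inner (z j - xi n.+2 j) (z j - xi n.+2 j).
pose Zv := \sum_j inner (z j - dual_extrap rho nu thl n.+1 j)
  (z j - dual_extrap rho nu thl n.+1 j).
pose tau := (t n.+1)^-1.
have M : kappa / t n.+1 ^+ 2 * U n.+1 - omega / t n.+1 ^+ 2 * U n
   + ((kappa - 1) * (t n.+1 - 1) - (1 - omega)) / t n.+1 ^+ 2 * Zd <=
   (1 - tau) * (kappa * Aw - Av) + tau * (kappa * Zw - Zv).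
  rewrite !mulr_sumr -!sumrB !mulr_sumr -!big_split /=.
  by apply: ler_sum => j _; exact: momentum_inner.
have tau0 : 0 <= tau by rewrite invr_ge0 ltW.
have tau1 : tau <= 1 by rewrite invf_le1.
have i0 : 0 <= (2 * nu)^-1 by rewrite invr_ge0 mulr_ge0 // ltW.
have h1 : (1 - tau) * ((2 * nu)^-1 * (kappa * Aw - Av) - N%:R * (eps n.+1 / s))
    <= (1 - tau) * (dual_gap n - dual_gap n.+1).
  rewrite ler_wpM2l ?subr_ge0 //; apply: (le_trans S1).
  by rewrite le_eqVlt; apply/orP; left; apply/eqP; rewrite /dual_gap; ring.
have h2 : tau * ((2 * nu)^-1 * (kappa * Zw - Zv) - N%:R * (eps n.+1 / s))
    <= tau * (- dual_gap n.+1).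
  rewrite ler_wpM2l //; apply: (le_trans S2).
  by rewrite le_eqVlt; apply/orP; left; apply/eqP; rewrite /dual_gap; ring.
have h3 := ler_wpM2l i0 M.
pose X k := K / (2 * nu * t k ^+ 2) * U k.
have X0 k : 0 <= X k.
  apply: mulr_ge0; last by apply: sumr_ge0 => j _; exact: inner_ge0.
  apply: divr_ge0; first by rewrite invr_ge0 subr_ge0 ltW.
  by rewrite mulr_ge0 ?sqr_ge0 // mulr_ge0 // ltW.
(* As [kappa] is not [K], a multiple of [s * Zd] survives in [M]; strong convexity of the gap
   absorbs it, whence the factor [1 + s]. *)
pose Y := m / 2 * Zd.
have YD : Y <= dual_gap n.
  apply: le_trans (dual_gap_ge n); rewrite /Y /Zd.
  have -> : \sum_j inner (z j - xi n.+1 j) (z j - xi n.+1 j) =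
      \sum_j inner (xi n.+1 j - z j) (xi n.+1 j - z j).
    by apply: eq_bigr => j _; rewrite -opprB innerNl innerNr opprK.
  by rewrite lerDr mulr_ge0 ?inner_ge0 // divr_ge0 // mulr_ge0 // ltW.
(* The recurrence for [t] matches the weight of [U n] to that in the previous Lyapunov value. *)
have oE : omega / t n.+1 ^+ 2 = K * (1 - tau) / t n ^+ 2.
  have -> : omega / t n.+1 ^+ 2 = K * (t n ^+ 2 * (1 - rho * t n.+1)) /
      (t n ^+ 2 * t n.+1 ^+ 2).
    by rewrite /omega; field; rewrite r1 !gt_eqF.
  by rewrite -tE /tau; field; rewrite r1 !gt_eqF.
have e3 : (2 * nu)^-1 * (kappa / t n.+1 ^+ 2 * U n.+1 - omega / t n.+1 ^+ 2 * U n
   + ((kappa - 1) * (t n.+1 - 1) - (1 - omega)) / t n.+1 ^+ 2 * Zd) =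
   (1 - s) * X n.+1 + s * ((2 * nu * t n.+1 ^+ 2)^-1 * U n.+1)
   - (1 - tau) * X n - s * ((1 - tau) * (tau * Y)).
  rewrite oE /X /Y /kappa /omega /tau.
  by field; rewrite r1 !gt_eqF.
rewrite e3 in h3.
have V0 : 0 <= s * ((2 * nu * t n.+1 ^+ 2)^-1 * U n.+1).
  rewrite mulr_ge0 ?(ltW s0) // mulr_ge0 //.
    by rewrite invr_ge0 mulr_ge0 ?sqr_ge0 // mulr_ge0 // ltW.
  by apply: sumr_ge0 => j _; exact: inner_ge0.
have h4 : s * ((1 - tau) * (tau * Y)) <= s * ((1 - tau) * dual_gap n).
  rewrite ler_wpM2l ?(ltW s0) // ler_wpM2l ?subr_ge0 //.
  have Y0 : 0 <= Y.
    apply: mulr_ge0; first by rewrite divr_ge0 //; exact: m_ge0.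
    by apply: sumr_ge0 => j _; exact: inner_ge0.
  by apply: le_trans YD; rewrite ler_piMl.
have h5 : 0 <= s * ((1 - tau) * X n).
  by rewrite mulr_ge0 ?(ltW s0) // mulr_ge0 ?subr_ge0.
have h6 : 0 <= s * dual_gap n.+1 by rewrite mulr_ge0 // ltW.
rewrite /lyapunov -/tau -/(U n) -/(U n.+1) -/(X n) -/(X n.+1).
move: h1 h2 h3 h4 h5 h6 V0.
move: (dual_gap n) (dual_gap n.+1) (X n) (X n.+1) (kappa * Aw - Av)
  (kappa * Zw - Zv) (N%:R * _) (s * (_ * U n.+1)) => D D' x x' a b e v.
move=> h1 h2 h3 h4 h5 h6 V0; lra.
Qed.

Lemma lyapunov_ge n :
  N%:R * nu / 2 * inner (A n.+1 - thetas) (A n.+1 - thetas) <= lyapunov n.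
Proof.
have [T1 _] := dfl_t_bounds rho_ge0 (ltW rho_lt1) n.
apply: le_trans (_ : dual_gap n <= _).
  apply: le_trans (dual_gap_ge n); rewrite lerDl.
  apply: mulr_ge0; first by rewrite divr_ge0 //; exact: m_ge0.
  by apply: sumr_ge0 => j _; exact: inner_ge0.
rewrite lerDl; apply: mulr_ge0; last by apply: sumr_ge0 => j _; exact: inner_ge0.
apply: divr_ge0; first by rewrite invr_ge0 subr_ge0 ltW.
by rewrite mulr_ge0 ?sqr_ge0 // mulr_ge0 // ltW.
Qed.

Variable gamma : R.
Hypotheses (gamma_gt0 : 0 < gamma) (cE : c = (1 - Num.sqrt rho) / (1 + gamma)).

(** The harmonic bound secures convergence when [rho = 0]. *)
Lemma dfl_avg_bounds :
  (exists2 C, 0 < C & forall n,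
     inner (A n.+1 - thetas) (A n.+1 - thetas) <= C * (1 - Num.sqrt rho) ^+ n) /\
  (exists C, forall n,
     inner (A n.+1 - thetas) (A n.+1 - thetas) <= C / n.+1%:R).
Proof.
have sr_lt1 : Num.sqrt rho < 1 by rewrite -sqrtr1 ltr_sqrt.
set a := 1 - Num.sqrt rho; have cE' : c = a / (1 + gamma) by exact: cE.
have a_gt0 : 0 < a by rewrite subr_gt0.
have a_le1 : a <= 1 by rewrite gerDl oppr_le0 sqrtr_ge0.
pose r := (Num.sqrt (1 + gamma))^-1.
have sg_gt1 : 1 < Num.sqrt (1 + gamma) by rewrite -[ltLHS]sqrtr1 ltr_sqrt ?ltrDl // addr_gt0.
have r_gt0 : 0 < r by rewrite invr_gt0; lra.
have r_lt1 : r < 1 by rewrite invf_lt1 //; lra.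
have r2 : (1 + gamma)^-1 = r ^+ 2 by rewrite exprVn sqr_sqrtr // addr_ge0 // ltW.
have w_gt0 : 0 < N%:R * nu / 2 by rewrite divr_gt0 // mulr_gt0 // ltr0n.
have Psi0 n : 0 <= lyapunov n.
  by apply: le_trans (lyapunov_ge n); rewrite mulr_ge0 ?inner_ge0 // ltW.
pose alpha n := 1 - (t n.+1)^-1.
have tb n := dfl_t_bounds rho_ge0 (ltW rho_lt1) n.+1.
have t_gt0 n : 0 < t n.+1 by have [] := tb n; lra.
have alpha0 n : 0 <= alpha n by rewrite subr_ge0 invf_le1 //; have [] := tb n.
have alpha_a n : alpha n <= a.
  by rewrite lerD2l lerN2 -[leRHS]div1r ler_pdivlMr //; have [] := tb n.
have alpha_n n : alpha n <= 1 - n.+2%:R^-1.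
  rewrite lerD2l lerN2 lef_pV2 ?posrE ?ltr0n //.
  by apply: dfl_t_le => //; exact: ltW.
have PsiS n : lyapunov n.+1 <=
    (1 + 2 * r ^+ n) * (alpha n * lyapunov n) + 4 * a ^+ n * r ^+ n.
  (* Since [c = a r^2], one factor [r^n] pays for [1/s] and another stays summable;
     [1 + s <= (1 - s)(1 + 4 s)] as [s <= 1/2]. *)
  pose s := r ^+ n / 2.
  have rn_gt0 : 0 < r ^+ n by rewrite exprn_gt0.
  have rn_le1 : r ^+ n <= 1 by rewrite exprn_ile1 // ltW.
  have s0 : 0 < s by rewrite divr_gt0.
  have s1 : s <= 1 by rewrite /s; lra.
  have := lyapunov_step n s0 s1; rewrite -/(alpha n).
  have -> : N%:R * (N%:R^-1 * c ^+ n.+1 / s) = 2 * (a * r ^+ 2) * (a ^+ n * r ^+ n).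
    have e : (a * r ^+ 2) ^+ n.+1 = a * r ^+ 2 * (a ^+ n * (r ^+ n * r ^+ n)).
      by rewrite exprS exprMn [(r ^+ 2) ^+ n]exprAC [(r ^+ n) ^+ 2]expr2.
    rewrite cE' r2 /s e.
    by field; rewrite pnatr_eq0 -lt0n N_gt0 gt_eqF.
  have E0 : 0 <= a ^+ n * r ^+ n by rewrite mulr_ge0 ?exprn_ge0 // ltW.
  have ar : a * r ^+ 2 <= 1.
    by rewrite mulr_ile1 ?exprn_ge0 ?exprn_ile1 // ltW.
  have E1 : 2 * (a * r ^+ 2) * (a ^+ n * r ^+ n) <= 2 * (a ^+ n * r ^+ n).
    by rewrite ler_wpM2r //; lra.
  have Y0 : 0 <= alpha n * lyapunov n by rewrite mulr_ge0.
  have -> : 1 + 2 * r ^+ n = 1 + 4 * s by rewrite /s; field.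
  rewrite -[4 * _ * _]mulrA.
  have s2 : s <= 2^-1 by rewrite /s; lra.
  move: (alpha n * lyapunov n) (a ^+ n * r ^+ n) (lyapunov n.+1) E0 E1 Y0
    => Y E P E0 E1 Y0 h.
  have s3 : 0 < 1 - s by lra.
  rewrite -(ler_pM2l s3).
  have sY : s * s * Y <= s * 2^-1 * Y by rewrite ler_wpM2r // ler_wpM2l // ltW.
  have sE : s * E <= 2^-1 * E by rewrite ler_wpM2r.
  have -> : (1 - s) * ((1 + 4 * s) * Y + 4 * E) =
    Y + 3 * (s * Y) - 4 * (s * s * Y) + 4 * E - 4 * (s * E) by ring.
  lra.
have B0 : 0 <= 4 :> R by [].
have [C C0 PC] := perturbed_geometric_bound a_gt0 (ltW r_gt0) r_lt1 B0
  Psi0 PsiS alpha_a.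
split.
  exists (C / (N%:R * nu / 2)); first exact: divr_gt0.
  move=> n; rewrite mulrAC ler_pdivlMr // mulrC.
  exact: le_trans (lyapunov_ge n) (PC n).
(* The geometric bound, with [a <= 1], makes the factor [2 r^n] an additive error [2 C r^n]. *)
have M0 : 0 <= 2 * C + 4 by rewrite addr_ge0 // mulr_ge0 // ltW.
have [n|C' PC'] := perturbed_harmonic_bound (ltW r_gt0) r_lt1 M0 (Psi := lyapunov).
  apply: (le_trans (PsiS n)).
  have rn : 0 <= r ^+ n by rewrite exprn_ge0 // ltW.
  have an : a ^+ n <= 1 by rewrite exprn_ile1 // ltW.
  have h1 : alpha n * lyapunov n <= (1 - n.+2%:R^-1) * lyapunov n.
    by rewrite ler_wpM2r.
  have h2 : alpha n * lyapunov n <= C.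
    apply: le_trans (_ : lyapunov n <= _).
      by rewrite ler_piMl //; exact: le_trans (alpha_a n) a_le1.
    by apply: (le_trans (PC n)); rewrite ler_piMr // ltW.
  have h3 : r ^+ n * (alpha n * lyapunov n) <= r ^+ n * C by rewrite ler_wpM2l.
  have h4 : a ^+ n * r ^+ n <= r ^+ n by rewrite ler_piMl.
  move: h1 h3 h4; rewrite -[4 * _ * _]mulrA.
  move: (r ^+ n) (alpha n * _) ((1 - n.+2%:R^-1) * lyapunov n) (a ^+ n * _)
    => v x y w h1 h3 h4.
  lra.
exists (C' / (N%:R * nu / 2)) => n.
rewrite mulrAC ler_pdivlMr // mulrC.
exact: le_trans (lyapunov_ge n) (PC' n).
Qed.

End Convergence.

(** * Convergence of the averages and the final estimates *)

Lemma row_norm_le_enorm (R : realType) (d : nat) (u : 'rV[R]_d) : `|u| <= enorm u.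
Proof.
rewrite /Num.norm /= mx_normrE; apply: bigmax_le => [|[i j] _ /=].
  exact: sqrtr_ge0.
by rewrite -sqrtr_sqr ler_wsqrtr // ord1 coord_sqr_le_inner.
Qed.

Lemma cvg_inner_le (R : realType) (d : nat) (u : nat -> 'rV[R]_d) l (C : R) :
  (forall n, inner (u n.+1 - l) (u n.+1 - l) <= C / n.+1%:R) -> u @ \oo --> l.
Proof.
move=> uC; apply/cvgrPdist_lt => e e0.
have [k kC] : exists k : nat, C / e ^+ 2 < k%:R.
  exists (Num.bound `|C / e ^+ 2|); apply: le_lt_trans (ler_norm _) _.
  exact: archi_boundP.
exists k.+1 => // -[//|n] /= kn.
(* Row vectors converge in the max norm, which the Euclidean norm dominates. *)
rewrite distrC; apply: le_lt_trans (row_norm_le_enorm _) _.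
rewrite -[e]gtr0_norm // -sqrtr_sqr ltr_sqrt ?exprn_gt0 //.
apply: (le_lt_trans (uC n)); rewrite ltr_pdivrMr ?ltr0n // mulrC.
rewrite -ltr_pdivrMr ?exprn_gt0 //; apply: (lt_le_trans kC).
by rewrite ler_nat; apply: ltnW.
Qed.

Theorem theorem3p3 (R : realType) (d N : nat) (f : 'I_N -> 'rV[R]_d -> R)
  (mu L : R) (thetas : 'rV[R]_d) (rho nu gamma : R)
  (thl : nat -> 'I_N -> 'rV[R]_d) :
  (0 < N)%N -> 0 < mu -> 0 < L ->
  (forall j, convex_fun (f j)) ->
  (forall j, strongly_convex mu (f j)) ->
  (forall j, L_smooth L (f j)) ->
  (forall th, (N%:R^-1 * \sum_(j < N) f j thetas) <= N%:R^-1 * \sum_(j < N) f j th) ->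
  0 <= rho -> rho <= nu / L -> 0 < nu -> nu <= mu -> 0 < gamma ->
  (forall j, thl 0%N j = 0) ->
  (forall (j : 'I_N) (n : nat),
     (dfl_Gamma f rho nu thl n j (thl n.+1 j)
       <= (N%:R^-1 * ((1 - Num.sqrt rho) / (1 + gamma)) ^+ n)%:E)%E) ->
  let E := fun th => N%:R^-1 * \sum_(j < N) f j th in
  dfl_avg thl @ \oo --> thetas /\
  (exists C1 : R, 0 < C1 /\ forall n,
     E (dfl_avg thl n) - E thetas <= C1 * enorm (dfl_avg thl n - thetas) ^+ 2) /\
  (exists C2 : R, 0 < C2 /\ forall n,
     enorm (dfl_avg thl n - thetas) ^+ 2 <= C2 * (1 - Num.sqrt rho) ^+ n).
Proof.
move=> N_gt0 mu_gt0 L_gt0 _ f_sc f_sm opt rho_ge0 rho_le nu_gt0 nu_le_mu gamma_gt0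
  thl0 gamma_le E.
have [G fG] := choice (fun j => L_smooth_bounds (f_sm j)).
have f_up j x w := (fG j x w).1.
have f_low j w := strongly_convex_subgradient (f_sc j) nu_le_mu
  (fun w => (fG j thetas w).2) w.
have N0 : 0 < N%:R^-1 :> R by rewrite invr_gt0 ltr0n.
have E_up th : E th <= E thetas + N%:R^-1 * inner (\sum_j G j thetas) (th - thetas)
    + L / 2 * inner (th - thetas) (th - thetas).
  set q := inner (th - thetas) _.
  have -> : L / 2 * q = N%:R^-1 * \sum_(j < N) L / 2 * q.
    by rewrite -natr_sum_const mulKf // pnatr_eq0 -lt0n.
  rewrite inner_suml /E -!mulrDr -!big_split ler_pM2l //.
  apply: ler_sum => j _; have := f_up j thetas (th - thetas).
  by rewrite addrCA subrr addr0.
have sumG : \sum_j G j thetas = 0.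
  apply: inner_eq0; set S := \sum_j _ in E_up *.
  have L0 : L != 0 by rewrite gt_eqF.
  (* A gradient step of length [1/L] from the minimizer would lower [E] by [|S|^2 / (2 L N^2)]. *)
  have := E_up (thetas - (N%:R * L)^-1 *: S).
  rewrite [thetas - _ - _]addrAC subrr add0r innerNl !innerNr opprK innerZl !innerZr => up.
  have : 0 <= - (2 * L * N%:R ^+ 2)^-1 * inner S S.
    have := le_trans (opt _ : E thetas <= E (thetas - _)) up.
    rewrite -addrA lerDl; congr (_ <= _); field.
    by rewrite L0 andbT pnatr_eq0 -lt0n.
  rewrite mulNr oppr_ge0 pmulr_rle0 => [S0|]; last first.
    by rewrite invr_gt0 !mulr_gt0 ?exprn_gt0 ?ltr0n.
  by apply/eqP; rewrite eq_le S0 inner_ge0.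
have xi_sub n j x := dfl_Gamma_subgradient nu_gt0 (gamma_le j n) x.
(* Tested at the iterate itself, the criterion for [n = 1] says that the tolerance is nonnegative.
   This covers dimension 0, where [mu <= L] may fail. *)
have sr_le1 : Num.sqrt rho <= 1.
  have := xi_sub 1%N (Ordinal N_gt0) (thl 2%N (Ordinal N_gt0)).
  rewrite lerDl pmulr_rge0 // expr1 pmulr_lge0 ?subr_ge0 //.
  by rewrite invr_gt0 addr_gt0.
have rho_le1 : rho <= 1 by rewrite -[rho]sqr_sqrtr // expr_le1 // sqrtr_ge0.
have rhoL : rho * L <= nu by rewrite -ler_pdivlMr.
have [rate harm] :
  (exists2 C, 0 < C & forall n, inner (dfl_avg thl n.+1 - thetas)
     (dfl_avg thl n.+1 - thetas) <= C * (1 - Num.sqrt rho) ^+ n.+1) /\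
  (exists C, forall n, inner (dfl_avg thl n.+1 - thetas)
     (dfl_avg thl n.+1 - thetas) <= C / n.+1%:R).
  have [rho1|rho_neq1] := eqVneq rho 1.
    have L_le_nu : L <= nu by rewrite rho1 mul1r in rhoL.
    have avgE n : dfl_avg thl n.+1 = thetas.
      apply: (dfl_avg_eq N_gt0 nu_gt0 thl0 sumG) => j.
      exact: (xi_eq_z thetas f_up xi_sub L_le_nu).
    by split; exists 1 => // n; rewrite avgE subrr inner0l ?divr_ge0 //;
      rewrite mul1r exprn_ge0 // subr_ge0.
  have rho_lt1 : rho < 1 by rewrite lt_neqAle rho_neq1.
  have a_gt0 : 0 < 1 - Num.sqrt rho by rewrite subr_gt0 -[ltRHS]sqrtr1 ltr_sqrt.
  have [[C C0 PC] harm] := dfl_avg_bounds N_gt0 nu_gt0 thl0 f_up f_low sumG xi_sub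
    rho_ge0 rho_lt1 rhoL gamma_gt0 erefl.
  (* Dividing by [1 - sqrt rho] shifts the exponent from [n] to [n.+1]. *)
  split=> //; exists (C / (1 - Num.sqrt rho)); first exact: divr_gt0.
  by move=> n; rewrite exprS mulrA divfK ?gt_eqF.
split.
  by case: harm => C; exact: cvg_inner_le.
split.
  exists (L / 2); split=> [|n]; first exact: divr_gt0.
  by have := E_up (dfl_avg thl n); rewrite sumG inner0l sqr_enorm; lra.
case: rate => C C0 PC.
(* The added term covers index 0, which [PC] leaves out. *)
pose C2 := C + inner (dfl_avg thl 0 - thetas) (dfl_avg thl 0 - thetas).
exists C2; split=> [|[|n]]; rewrite ?sqr_enorm.
- by rewrite ltr_wpDr ?inner_ge0.
- by rewrite expr0 mulr1 /C2 lerDr ltW.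
apply: (le_trans (PC n)); rewrite ler_wpM2r ?exprn_ge0 ?subr_ge0 //.
by rewrite /C2 lerDl inner_ge0.
Qed.
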